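(* Let $C$ be a linear $[n,k,d]_q$ NMDS code with $d=n-k$, and for $m\ge1$ let $C_m$ be its $m$-lifted code over $\mathbb{F}_{q^m}$ (an $[n,k,n-k]_{q^m}$ NMDS code, $C_1=C$). Then for all $m\ge1$ and $s\ge1$, $$A_{d+s}(C_m)=\binom{n}{k-s}\sum_{j=0}^{s-1}(-1)^j\binom{d+s}{j}\left(q^{m(s-j)}-1\right)+(-1)^s\binom{k}{s}\frac{A_d(C)}{q-1}(q^m-1).$$ Moreover, if $A_d(C)=\binom{n}{k-1}\frac{q-1}{k}$ (which implies $A_{d+1}(C)=0$), then for all $m\ge1$, $$A_d(C_m)=\binom{n}{k-1}\frac{q^m-1}{k},\qquad A_{d+1}(C_m)=0.$$
   Context: An $[n,k,d]_q$ code is a $k$-dimensional linear subspace of $\mathbb{F}_q^n$ with minimum Hamming distance $d$; $A_i(C)$ is its number of codewords of Hamming weight $i$; $\binom{a}{b}=0$ for $b<0$. A linear $[n,k,n-k]_q$ code $C$ is near-MDS (NMDS) if its dual $C^\perp$ is an $[n,n-k,k]_q$ code. For a linear code $C$ over $\mathbb{F}_q$ with parity check matrix $H$, the $m$-lifted code $C_m$ ($m\ge1$) is $\{x\in\mathbb{F}_{q^m}^n:Hx^T=0\}$, i.e. the code over $\mathbb{F}_{q^m}$ with the same parity check matrix (equivalently the $\mathbb{F}_{q^m}$-span of $C$). *)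

(* Defs.v *)
From HB Require Import structures.
From mathcomp Require Import all_boot all_order all_algebra all_field.

Set Implicit Arguments.
Unset Strict Implicit.
Unset Printing Implicit Defensive.

Import Order.TTheory GRing.Theory Num.Theory.
Local Open Scope ring_scope.

(* 'C(n, z) with a possibly negative lower index, where it is 0; 'C(n, k - s)
   with truncated subtraction would wrongly give 'C(n, 0) = 1 for k < s. *)
Definition binz (n : nat) (z : int) : nat :=
  if z is Posz b then 'C(n, b) else 0%N.

Definition hdist (F : finFieldType) (n : nat) (x y : 'rV[F]_n) : nat :=
  #|[set i : 'I_n | x 0 i != y 0 i]|.

Definition hweight (F : finFieldType) (n : nat) (x : 'rV[F]_n) : nat :=
  #|[set i : 'I_n | x 0 i != 0]|.

Definition is_min_distance (F : finFieldType) (n : nat)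
    (C : {vspace 'rV[F]_n}) (d : nat) : Prop :=
  (exists x y : 'rV[F]_n, [/\ x \in C, y \in C, x != y & hdist x y = d]) /\
  (forall x y : 'rV[F]_n, x \in C -> y \in C -> x != y -> (d <= hdist x y)%N).

Definition is_code (F : finFieldType) (n k d : nat)
    (C : {vspace 'rV[F]_n}) : Prop :=
  \dim C = k /\ is_min_distance C d.

Definition dual_code (F : finFieldType) (n : nat)
    (C : {vspace 'rV[F]_n}) : {vspace 'rV[F]_n} :=
  (\bigcap_(x : 'rV[F]_n | x \in C) lker (linfun (mulmx x \o trmx)))%VS.

Lemma mem_dual_code (F : finFieldType) (n : nat) (C : {vspace 'rV[F]_n})
    (y : 'rV[F]_n) :
  reflect (forall x, x \in C -> x *m y^T = 0) (y \in dual_code C).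
Proof.
rewrite /dual_code memvE.
apply: (iffP subv_bigcapP) => h x xC.
  by have := h x xC; rewrite -memvE memv_ker lfunE /= => /eqP.
by rewrite -memvE memv_ker lfunE /= h.
Qed.

Definition is_NMDS (F : finFieldType) (n k : nat)
    (C : {vspace 'rV[F]_n}) : Prop :=
  is_code k (n - k)%N C /\ is_code (n - k)%N k (dual_code C).

Definition null_code (F : finFieldType) (r n : nat)
    (H : 'M[F]_(r, n)) : {vspace 'rV[F]_n} :=
  lker (linfun (mulmx H \o trmx)).

Lemma mem_null_code (F : finFieldType) (r n : nat) (H : 'M[F]_(r, n))
    (x : 'rV[F]_n) :
  (x \in null_code H) = (H *m x^T == 0).
Proof. by rewrite memv_ker lfunE. Qed.

(* When \dim C = k, such an H with n - k rows automatically has full rank. *)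
Definition is_parity_check (F : finFieldType) (r n : nat)
    (H : 'M[F]_(r, n)) (C : {vspace 'rV[F]_n}) : Prop :=
  C = null_code H.

(* K plays the role of the field with q ^ m elements, and iota that of the
   inclusion of the field with q elements. *)
Definition lifted_code (F K : finFieldType) (iota : {rmorphism F -> K})
    (r n : nat) (H : 'M[F]_(r, n)) : {vspace 'rV[K]_n} :=
  null_code (map_mx iota H).

Definition num_weight (F : finFieldType) (n : nat) (i : nat)
    (C : {vspace 'rV[F]_n}) : nat :=
  #|[set x : 'rV[F]_n | (x \in C) && (hweight x == i)]|.

(* Main.v *)
(* For a set T of coordinates, the subcode of words supported in T is cut out
   by a matrix over F, so its dimension e(T) is the same for every lifted code.
   In the near-MDS case e(T) = 0 for #|T| < d, e(T) is 0 or 1 for #|T| = d and,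
   by the dual distance, e(T) = #|T| - d for #|T| > d. Hence the numbers
   B_t = \sum_(#|T| = t) (Q ^ e(T) - 1), Q = q ^ m, are known except for the
   number N of T with #|T| = d and e(T) = 1, which does not depend on m and is
   A_d(C) / (q - 1). Inclusion-exclusion recovers the weight distribution:
   A_w = \sum_j (-1)^j 'C(n - w + j, j) B_(w-j). *)
Require Import Defs.
From HB Require Import structures.
From mathcomp Require Import all_boot all_order all_algebra all_field.
From mathcomp Require Import zify ring.

Set Implicit Arguments.
Unset Strict Implicit.
Unset Printing Implicit Defensive.

Import Order.TTheory GRing.Theory Num.Theory.
Local Open Scope ring_scope.

(** * Supports, null codes and their duals *)

Definition supp (F : finFieldType) (n : nat) (x : 'rV[F]_n) : {set 'I_n} :=
  [set i | x 0 i != 0].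

Lemma hweight_eq0 (F : finFieldType) n (x : 'rV[F]_n) :
  (hweight x == 0%N) = (x == 0).
Proof.
rewrite cards_eq0; apply/eqP/eqP => [x0 | ->]; last first.
  by apply/setP => i; rewrite !inE mxE eqxx.
apply/rowP => i; rewrite mxE; apply/eqP.
by have /setP/(_ i) := x0; rewrite !inE => /negbFE.
Qed.

Lemma min_distanceP (F : finFieldType) n (C : {vspace 'rV[F]_n}) d :
  is_min_distance C d <->
  (exists2 x, (x \in C) && (x != 0) & hweight x = d) /\
  (forall x, x \in C -> x != 0 -> (d <= hweight x)%N).
Proof.
have hdistE (x y : 'rV[F]_n) : hdist x y = hweight (x - y).
  by apply: eq_card => i; rewrite !inE !mxE subr_eq0.
split=> [[[x [y [xC yC xy dxy]]] dmin] | [[x /andP[xC x0] wx] dmin]]; split.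
- by exists (x - y); rewrite -?hdistE // subr_eq0 xy rpredB.
- move=> x' x'C x'0; have := dmin x' 0 x'C (mem0v C) x'0.
  by rewrite hdistE subr0.
- by exists x, 0; rewrite hdistE subr0; split=> //; apply: mem0v.
- by move=> y z yC zC yz; rewrite hdistE dmin ?rpredB // subr_eq0.
Qed.

Lemma mem_null_code_kermx (F : finFieldType) r n (H : 'M[F]_(r, n)) x :
  (x \in null_code H) = (x <= kermx H^T)%MS.
Proof.
rewrite mem_null_code sub_kermx.
by rewrite -[x *m _]trmxK trmx_mul trmxK trmx_eq0.
Qed.

Lemma dim_null_code (F : finFieldType) r n (H : 'M[F]_(r, n)) :
  \dim (null_code H) = (n - \rank H)%N.
Proof.
(* The code is the row space of [kermx H^T]; a basis of it gives the injective parametrisation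
   [f]. *)
pose B := row_base (kermx H^T).
pose f : 'Hom('rV[F]_(\rank (kermx H^T)), 'rV[F]_n) := linfun (mulmxr B).
have -> : null_code H = (f @: fullv)%VS.
  apply/vspaceP => x; rewrite mem_null_code_kermx -(eq_row_base (kermx H^T)).
  apply/submxP/memv_imgP => [[u ->] | [u _ ->]]; exists u; rewrite ?memvf //.
    by rewrite lfunE.
  by rewrite lfunE.
rewrite limg_dim_eq.
  by rewrite dimvf dim_matrix mul1r mxrank_ker mxrank_tr.
apply/eqP; rewrite -subv0; apply/subvP => u; rewrite memv_cap memvf /= memv_ker.
rewrite lfunE /= memv0 => /eqP uB0; apply/eqP.
by apply: (row_free_inj (row_base_free (kermx H^T))); rewrite uB0 mul0mx.
Qed.

(** The rows of [kermx H^T] span the code, so being orthogonal to the code amounts to being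
    orthogonal to these rows. *)
Lemma dual_null_code (F : finFieldType) r n (H : 'M[F]_(r, n)) :
  dual_code (null_code H) = null_code (kermx H^T).
Proof.
apply/vspaceP => y; rewrite mem_null_code.
apply/mem_dual_code/eqP => [dualy | kery x].
  apply/row_matrixP => i; rewrite row_mul row0 dualy //.
  by rewrite mem_null_code_kermx row_sub.
by rewrite mem_null_code_kermx => /submxP[u ->]; rewrite -mulmxA kery mulmx0.
Qed.

(** Kernels commute with field extension; this is what carries the dual distance over to [K]. *)
Lemma dual_lifted_code (F K : finFieldType) (iota : {rmorphism F -> K})
    r n (H : 'M[F]_(r, n)) :
  dual_code (lifted_code iota H) = lifted_code iota (kermx H^T).
Proof. by rewrite dual_null_code map_trmx -map_kermx. Qed.

(** * Shortened codes and their dimensions *)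

(* A parity check matrix of the subcode of words supported in [T]. *)
Definition shorten_mx (F : finFieldType) r n (H : 'M[F]_(r, n))
    (T : {set 'I_n}) : 'M[F]_(r + n, n) :=
  col_mx H (diag_mx (\row_i (i \notin T)%:R)).

Definition shorten_dim (F : finFieldType) r n (H : 'M[F]_(r, n)) T : nat :=
  \dim (null_code (shorten_mx H T)).

Lemma mem_shorten (F : finFieldType) r n (H : 'M[F]_(r, n)) T x :
  (x \in null_code (shorten_mx H T)) =
  (x \in null_code H) && (supp x \subset T).
Proof.
rewrite !mem_null_code mul_col_mx col_mx_eq0; congr (_ && _).
apply/eqP/subsetP => [Dx0 i | xT].
  rewrite inE; apply: contraR => iT.
  by have /colP/(_ i) := Dx0; rewrite mul_diag_mx !mxE iT mul1r => ->.
apply/colP => i; rewrite mul_diag_mx !mxE.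
case: (boolP (i \in T)) => iT /=; first by rewrite mul0r.
rewrite mul1r; apply/eqP; apply: contraNT iT => xi.
by apply: xT; rewrite inE.
Qed.

(** Field extension keeps the rank, and [iota] fixes the 0/1 entries of the diagonal block. *)
Lemma shorten_dim_map (F K : finFieldType) (iota : {rmorphism F -> K})
    r n (H : 'M[F]_(r, n)) T :
  shorten_dim (map_mx iota H) T = shorten_dim H T.
Proof.
rewrite /shorten_dim !dim_null_code; congr (_ - _)%N.
rewrite -(mxrank_map iota) map_col_mx map_diag_mx; congr (\rank (col_mx _ _)).
by congr diag_mx; apply/rowP => i; rewrite !mxE rmorph_nat.
Qed.

Lemma shorten_dim_eq0P (F : finFieldType) r n (H : 'M[F]_(r, n))
    (T : {set 'I_n}) :
  reflect (forall x, x \in null_code H -> supp x \subset T -> x = 0)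
          (shorten_dim H T == 0%N).
Proof.
rewrite dimv_eq0; apply: (iffP eqP) => [T0 x xH xT | T0].
  by apply/eqP; rewrite -memv0 -T0 mem_shorten xH.
apply/eqP; rewrite -subv0; apply/subvP => x; rewrite mem_shorten memv0.
by case/andP=> xH xT; rewrite (T0 x).
Qed.

(** Rephrases the minimum distance through dimensions of shortened codes, which do not change under
    lifting. *)
Lemma min_distance_shorten (F : finFieldType) r n (H : 'M[F]_(r, n)) d :
  is_min_distance (null_code H) d <->
  (exists2 T : {set 'I_n}, #|T| = d & shorten_dim H T != 0%N) /\
  (forall T : {set 'I_n}, (#|T| < d)%N -> shorten_dim H T = 0%N).
Proof.
rewrite min_distanceP; split=> [[[x /andP[xH x0] wx] dmin] | [[T dT T0] dmin]].
- split=> [|T dT].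
    exists (supp x) => //; apply: contra x0 => /shorten_dim_eq0P x0.
    by rewrite (x0 x).
  apply/eqP/shorten_dim_eq0P => y yH yT; apply: contraTeq dT => y0.
  by rewrite -leqNgt (leq_trans (dmin y yH y0)) // subset_leq_card.
- have dle x : x \in null_code H -> x != 0 -> (d <= hweight x)%N.
    move=> xH; apply: contraNleq => /dmin/eqP/shorten_dim_eq0P x0.
    by rewrite (x0 x).
  split=> //; move: T0; rewrite dimv_eq0 -vpick0.
  set x := vpick _ => x0; have := memv_pick (null_code (shorten_mx H T)).
  rewrite -/x mem_shorten => /andP[xH xT]; exists x; first by rewrite xH.
  by apply/eqP; rewrite eqn_leq dle // -dT subset_leq_card.
Qed.

(** * Parameters of lifted codes *)

Lemma is_code_lifted (F K : finFieldType) (iota : {rmorphism F -> K})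
    r n (H : 'M[F]_(r, n)) k d :
  is_code k d (null_code H) -> is_code k d (lifted_code iota H).
Proof.
case=> dimC /min_distance_shorten[[T dT T0] dmin]; split.
  by rewrite dim_null_code mxrank_map -dim_null_code.
apply/min_distance_shorten; split=> [|S dS].
  by exists T; rewrite ?shorten_dim_map.
by rewrite shorten_dim_map dmin.
Qed.

Lemma is_NMDS_lifted (F K : finFieldType) (iota : {rmorphism F -> K})
    r n (H : 'M[F]_(r, n)) k :
  is_NMDS k (null_code H) -> is_NMDS k (lifted_code iota H).
Proof.
case=> codeH codeH'; split; first exact: is_code_lifted.
by rewrite dual_lifted_code; apply: is_code_lifted; rewrite -dual_null_code.
Qed.

(** The case [m = 1]: an injective [iota] between finite fields of equal size is bijective, so words
    over [K] descend to [F]. *)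
Lemma lifted_code_bij (F K : finFieldType) (iota : {rmorphism F -> K})
    r n (H : 'M[F]_(r, n)) :
  #|K| = #|F| ->
  [set y : 'rV[K]_n | y \in lifted_code iota H] =
  [set map_mx iota x | x : 'rV[F]_n in null_code H].
Proof.
move=> cardKF.
have [g gK Kg] : bijective iota.
  by apply: inj_card_bij; rewrite ?cardKF //; apply: fmorph_inj.
have memE x : (map_mx iota x \in lifted_code iota H) = (x \in null_code H).
  by rewrite !mem_null_code map_trmx -map_mxM map_mx_eq0.
apply/setP => y; rewrite inE; apply/idP/imsetP => [yH | [x xH ->]].
  have Ey : y = map_mx iota (map_mx g y).
    by apply/matrixP => i j; rewrite !mxE Kg.
  by exists (map_mx g y); rewrite // -memE -Ey.
by rewrite memE.
Qed.

Lemma lifted_code_id (F : finFieldType) r n (H : 'M[F]_(r, n)) :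
  lifted_code (idfun : {rmorphism F -> F}) H = null_code H.
Proof. by rewrite /lifted_code map_mx_id. Qed.

(** * Shortened dimensions from the dual distance *)

(** Subadditivity of the rank gives the upper bound for [T] and for [~: T]. The two matrices sum to
    the identity, of rank [n], so both bounds are equalities. *)
Lemma rank_diag_indicator (F : finFieldType) n (T : {set 'I_n}) :
  \rank (diag_mx (\row_i (i \in T)%:R : 'rV[F]_n)) = #|T|.
Proof.
pose D (S : {set 'I_n}) := diag_mx (\row_i (i \in S)%:R : 'rV[F]_n).
have rankD (S : {set 'I_n}) : (\rank (D S) <= #|S|)%N.
  have -> : D S = \sum_(i in S) delta_mx i i.
    rewrite /D diag_mx_sum_delta [RHS]big_mkcond; apply: eq_bigr => i _.
    by rewrite mxE; case: ifP; rewrite ?scale1r ?scale0r.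
  rewrite -sum1_card; apply: (big_ind2 (fun (A : 'M_n) m => \rank A <= m)%N).
  - by rewrite mxrank0.
  - by move=> A a B b hA hB; apply: leq_trans (mxrank_add _ _) (leq_add hA hB).
  - by move=> i _; rewrite mxrank_delta.
have D1 : D T + D (~: T) = 1%:M.
  rewrite /D -linearD /= -diag_const_mx; congr diag_mx; apply/rowP => i.
  by rewrite !mxE inE; case: (i \in T); rewrite ?addr0 ?add0r.
have := mxrank_add (D T) (D (~: T)); rewrite D1 mxrank1.
have := rankD T; have := rankD (~: T); have := cardsC T; rewrite card_ord.
rewrite -/(D T); lia.
Qed.

Lemma shorten_dim_mono (F : finFieldType) r n (H : 'M[F]_(r, n))
    (S T : {set 'I_n}) :
  S \subset T -> (shorten_dim H S <= shorten_dim H T)%N.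
Proof.
move=> ST; apply: dimvS; apply/subvP => x.
rewrite (mem_shorten H S) (mem_shorten H T) => /andP[-> xS].
exact: subset_trans xS ST.
Qed.

(* The rows of [H] span the dual code, so they are independent of the unit
   vectors outside [T] when the dual distance exceeds [n - #|T|]. *)
Lemma shorten_dim_large (F : finFieldType) r n (H : 'M[F]_(r, n)) k
    (T : {set 'I_n}) :
  is_min_distance (dual_code (null_code H)) k -> (n - #|T| < k)%N ->
  shorten_dim H T = (#|T| - \rank H)%N.
Proof.
move=> /min_distanceP[_ kmin] Tk.
rewrite /shorten_dim dim_null_code /shorten_mx -addsmxE.
set D := diag_mx _.
have rD : \rank D = (n - #|T|)%N.
  have -> : D = diag_mx (\row_i (i \in ~: T)%:R).
    by congr diag_mx; apply/rowP => i; rewrite !mxE inE.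
  by rewrite rank_diag_indicator cardsCs setCK card_ord.
have cap0 : (H :&: D = 0)%MS.
  apply/eqP; rewrite -submx0; apply/rV_subP => v.
  rewrite sub_capmx submx0 => /andP[/submxP[u Hu] /submxP[w Dw]].
  apply: contraTT Tk => v0; rewrite -leqNgt.
  apply: leq_trans (kmin v _ v0) _.
    rewrite dual_null_code mem_null_code Hu trmx_mul mulmxA mulmx_ker.
    by rewrite mul0mx.
  have <- : #|~: T| = (n - #|T|)%N by rewrite cardsCs setCK card_ord.
  apply: subset_leq_card; apply/subsetP => i; rewrite !inE Dw.
  by apply: contraNN => iT; rewrite mul_mx_diag !mxE iT mulr0.
have := mxrank_sum_cap H D; rewrite cap0 mxrank0 addn0 rD => ->.
have := max_card T; rewrite card_ord; lia.
Qed.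

(** * Double counting and binomial inversion *)

Lemma card_shorten (F : finFieldType) r n (H : 'M[F]_(r, n))
    (T : {set 'I_n}) :
  #|[set x in null_code H | (x != 0) && (supp x \subset T)]| =
  (#|F| ^ shorten_dim H T).-1%N.
Proof.
rewrite /shorten_dim -card_vspace [in RHS](cardD1 0) mem0v /=.
by apply: eq_card => x; rewrite !inE (mem_shorten H T) andbCA.
Qed.

Lemma bin_trinomial N a b :
  (b <= a)%N -> ('C(N, a) * 'C(a, b) = 'C(N, b) * 'C(N - b, a - b))%N.
Proof.
move=> ba; case: (leqP a N) => [aN | Na]; last first.
  rewrite bin_small // mul0n; case: (leqP b N) => bN; last by rewrite bin_small.
  by rewrite ['C(N - b, _)]bin_small ?muln0 //; lia.
have fpos : (0 < b`! * (a - b)`! * (N - a)`!)%N by rewrite !muln_gt0 !fact_gt0.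
apply/eqP; rewrite -(eqn_pmul2r fpos); apply/eqP.
have bN := leq_trans ba aN; have abN : (a - b <= N - b)%N by lia.
have E : (N - b - (a - b) = N - a)%N by lia.
transitivity N`!.
  by rewrite -(bin_fact aN) -(bin_fact ba); ring.
by rewrite -(bin_fact bN) -(bin_fact abN) E; ring.
Qed.

(** The expansion of [(1 - 1) ^+ v], padded with zero terms up to [w]. *)
Lemma alternating_bin_sum (v w : nat) :
  (v <= w)%N ->
  \sum_(0 <= j < w.+1) (-1) ^+ j * 'C(v, j)%:R = (v == 0%N)%:R :> rat.
Proof.
move=> vw; rewrite (@big_cat_nat _ _ _ v.+1) //= [X in _ + X]big_nat_cond.
rewrite [X in _ + X]big1 ?addr0; last first.
  by move=> j /andP[/andP[vj _] _]; rewrite bin_small ?mulr0.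
have := exprDn (1 : rat) (-1) v; rewrite subrr expr0n => ->.
rewrite big_mkord; apply: eq_bigr => j _.
by rewrite expr1n mul1r mulr_natr.
Qed.

(** Complements turn these sets into subsets of [~: A]. The lower index [#|T| - t] gives 0 when
    [t < #|A|], whereas a truncated [t - #|A|] would give 1. *)
Lemma card_supersets (T : finType) (A : {set T}) (t : nat) :
  (t <= #|T|)%N ->
  #|[set S : {set T} | (#|S| == t) && (A \subset S)]| =
  'C(#|T| - #|A|, #|T| - t).
Proof.
move=> tT; have <- : #|~: A| = (#|T| - #|A|)%N by rewrite cardsCs setCK.
rewrite -cards_draws -[RHS](card_imset _ (can_inj (@setCK T))).
apply: eq_card => S; rewrite inE; apply/andP/imsetP => [[/eqP St AS] | [R]].
  exists (~: S); last by rewrite setCK.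
  by rewrite inE setCS AS cardsCs setCK St eqxx.
rewrite inE => /andP[RA /eqP Rt] ->; rewrite cardsCs setCK Rt subsetC RA.
by split=> //; apply/eqP; lia.
Qed.

(** This is [B_t], kept as a double count: summing over [T] first involves [shorten_dim], summing
    over [x] first involves weights. *)
Definition num_covered (F : finFieldType) n (C : {vspace 'rV[F]_n})
    (t : nat) : nat :=
  \sum_(T : {set 'I_n} | #|T| == t)
    #|[set x in C | (x != 0%R) && (supp x \subset T)]|.

Lemma num_coveredE (F : finFieldType) n (C : {vspace 'rV[F]_n}) (t : nat) :
  (t <= n)%N ->
  num_covered C t = (\sum_(x in C | x != 0%R) 'C(n - hweight x, n - t))%N.
Proof.
move=> tn.
transitivity (\sum_(T : {set 'I_n} | #|T| == t)
    \sum_(x in C | x != 0%R) (supp x \subset T : nat))%N.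
  apply: eq_bigr => T _; rewrite -sum1_card -[RHS]big_mkcondr /=.
  by apply: eq_bigl => x; rewrite inE andbA.
rewrite exchange_big /=; apply: eq_bigr => x _.
have := @card_supersets _ (supp x) t; rewrite card_ord => /(_ tn) <-.
rewrite -sum1_card -big_mkcondr /=.
by apply: eq_bigl => T; rewrite inE.
Qed.

(** Inverts [num_coveredE]: a nonzero word of weight [u] contributes ['C(n - u, n - w)] times an
    alternating sum with upper index [w - u], which leaves only [u = w]. Positivity of [w] keeps the
    zero word out of the count. *)
Lemma num_weight_covered (F : finFieldType) n (C : {vspace 'rV[F]_n})
    (w : nat) :
  (0 < w <= n)%N ->
  (num_weight w C)%:R =
  \sum_(0 <= j < w.+1)
    (-1) ^+ j * 'C(n - (w - j), j)%:R * (num_covered C (w - j))%:R :> rat.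
Proof.
case/andP=> w0 wn.
transitivity (\sum_(x in C | x != 0) (hweight x == w)%:R : rat).
  rewrite -[RHS]natr_sum -big_mkcondr /= sum1_card; congr _%:R.
  apply: eq_card => x; rewrite !inE unfold_in /= -andbA; congr (_ && _).
  rewrite -hweight_eq0; case: eqP => [-> | _]; last by rewrite andbF.
  by rewrite -lt0n w0.
transitivity (\sum_(x in C | x != 0) \sum_(0 <= j < w.+1)
    (-1) ^+ j * 'C(n - (w - j), j)%:R *
    'C(n - hweight x, n - (w - j))%:R : rat).
  apply: eq_bigr => x _; set u := hweight x.
  have un : (u <= n)%N by rewrite -[n in (_ <= n)%N]card_ord max_card.
  have Ej j : (j < w.+1)%N ->
      (-1) ^+ j * 'C(n - (w - j), j)%:R * 'C(n - u, n - (w - j))%:R =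
      'C(n - u, n - w)%:R * ((-1) ^+ j * 'C(n - u - (n - w), j)%:R) :> rat.
    move=> jw; rewrite -mulrA -natrM [RHS]mulrCA -natrM; congr (_ * _%:R).
    have jE : (j = n - (w - j) - (n - w))%N by lia.
    rewrite [X in (_ = _ * 'C(_, X))%N]jE -bin_trinomial; last by lia.
    rewrite mulnC -[in LHS](@bin_sub (n - (w - j)) j); last by lia.
    by congr (_ * 'C(_, _))%N; lia.
  rewrite (eq_big_nat _ _ (F2 := fun j => 'C(n - u, n - w)%:R *
     ((-1) ^+ j * 'C(n - u - (n - w), j)%:R))) => [|j /andP[_ /Ej] //].
  rewrite -mulr_sumr alternating_bin_sum; last by lia.
  (* For [u > w] the truncated upper index is 0 and the alternating sum is 1, but the outer binomial
     vanishes. *)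
  case: (ltngtP u w) => [uw|wu|->]; last by rewrite binn subnn mul1r.
    by rewrite (_ : _ == 0%N = false) ?mulr0 //; lia.
  by rewrite bin_small ?mul0r //; lia.
rewrite exchange_big /=; apply: eq_big_nat => j jw.
by rewrite num_coveredE ?natr_sum ?mulr_sumr //; lia.
Qed.

(** * Weight distribution of a near-MDS code *)

(** This is [N]; for a near-MDS code a nonzero dimension here equals 1, by [shorten_dim_min_le1]. *)
Definition num_min_supports (F : finFieldType) r n (H : 'M[F]_(r, n))
    (d : nat) : nat :=
  #|[set T : {set 'I_n} | (#|T| == d) && (shorten_dim H T != 0%N)]|.

Section NearMDS.

Variables (F : finFieldType) (n k : nat) (H : 'M[F]_(n - k, n)).
Hypothesis nmds : is_NMDS k (null_code H).

Local Notation d := (n - k)%N.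
Local Notation C := (null_code H).
Local Notation N := (num_min_supports H d).

(** Both minimum distances are attained by nonzero words, so neither the code nor its dual is
    trivial. *)
Lemma NMDS_bounds : (0 < k < n)%N /\ \rank H = d.
Proof.
case: nmds => [[dimC minC] [dimD minD]].
have pos (U : {vspace 'rV[F]_n}) e : is_min_distance U e -> (0 < \dim U)%N.
  case/min_distanceP => [[x /andP[xU x0] _] _]; rewrite lt0n dimv_eq0.
  by apply: contraNneq x0 => U0; rewrite -memv0 -U0.
have := pos _ _ minC; have := pos _ _ minD; rewrite dimC dimD.
by move: dimC; rewrite dim_null_code; have := rank_leq_col H; split; lia.
Qed.

Lemma shorten_dim_NMDS (T : {set 'I_n}) :
  (d < #|T|)%N -> shorten_dim H T = (#|T| - d)%N.
Proof.
move=> dT; have [kn rH] := NMDS_bounds; case: nmds => _ [_ minD].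
by rewrite (shorten_dim_large minD) ?rH //; lia.
Qed.

(** Adding one coordinate outside [T] gives a set of size [d + 1], whose shortened dimension is
    exactly 1. *)
Lemma shorten_dim_min_le1 (T : {set 'I_n}) :
  #|T| = d -> (shorten_dim H T <= 1)%N.
Proof.
move=> Td; have [kn _] := NMDS_bounds.
have [i iT] : exists i, i \in ~: T.
  by apply/card_gt0P; rewrite cardsCs setCK card_ord Td; lia.
apply: leq_trans (shorten_dim_mono H (subsetUr [set i] T)) _.
have cT : #|i |: T| = d.+1 by rewrite cardsU1 -in_setC iT Td.
by rewrite shorten_dim_NMDS cT; lia.
Qed.

Lemma num_covered_lt t : (t < d)%N -> num_covered C t = 0%N.
Proof.
move=> td; rewrite /num_covered big1 // => T /eqP Tt.
case: nmds => [[_ /min_distance_shorten[_ minC]] _].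
by rewrite card_shorten minC ?Tt.
Qed.

Lemma num_covered_min : num_covered C d = (N * #|F|.-1)%N.
Proof.
rewrite /num_covered /num_min_supports -sum1_card big_distrl /=.
under [RHS]eq_bigl do rewrite inE.
rewrite big_mkcondr; apply: eq_bigr => T /eqP /shorten_dim_min_le1.
by rewrite card_shorten mul1n; case: shorten_dim => [|[|]].
Qed.

Lemma num_covered_gt t :
  (d < t)%N -> num_covered C t = ('C(n, t) * (#|F| ^ (t - d)).-1)%N.
Proof.
move=> dt; rewrite /num_covered.
rewrite (eq_bigr (fun=> (#|F| ^ (t - d)).-1)) => [|T /eqP Tt].
  rewrite sum_nat_const -[X in 'C(X, _)]card_ord -card_draws; congr (_ * _)%N.
  by apply: eq_card => T; rewrite inE.
by rewrite card_shorten shorten_dim_NMDS Tt ?dt.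
Qed.

Lemma natr_pred_card e : ((#|F| ^ e).-1)%:R = #|F|%:R ^+ e - 1 :> rat.
Proof.
by rewrite -subn1 natrB ?natrX // expn_gt0 (leq_trans _ (finNzRing_gt1 F)).
Qed.

Lemma num_weight_min : (num_weight d C)%:R = N%:R * (#|F|%:R - 1) :> rat.
Proof.
have [kn _] := NMDS_bounds.
rewrite num_weight_covered; last by lia.
rewrite big_nat_recl // big_nat_cond big1 ?addr0; last first.
  by move=> j jd; rewrite num_covered_lt ?mulr0 //; lia.
by rewrite subn0 bin0 !mul1r num_covered_min natrM -(natr_pred_card 1) expn1.
Qed.

Lemma num_weight_NMDS s :
  (0 < s)%N ->
  (num_weight (d + s) C)%:R =
  (binz n (k%:Z - s%:Z))%:R *
    (\sum_(0 <= j < s)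
       (-1) ^+ j * 'C(d + s, j)%:R * (#|F|%:R ^+ (s - j) - 1)) +
  (-1) ^+ s * 'C(k, s)%:R * (N%:R * (#|F|%:R - 1)) :> rat.
Proof.
move=> s0; have [kn _] := NMDS_bounds.
(* For [s > k] the weight [d + s] exceeds [n], and both binomials on the right vanish. *)
case: (leqP s k) => [sk | ks]; last first.
  have -> : num_weight (d + s) C = 0%N.
    apply: eq_card0 => x; rewrite inE; apply/negbTE/nandP; right.
    have : (hweight x <= n)%N by rewrite -[n in (_ <= n)%N]card_ord max_card.
    by lia.
  have -> : binz n (k%:Z - s%:Z) = 0%N.
    by case E : (k%:Z - s%:Z) => [a|a] //; lia.
  by rewrite (bin_small ks) mulr0 !mul0r addr0.
have -> : binz n (k%:Z - s%:Z) = 'C(n, d + s).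
  rewrite subzn //= -bin_sub; last by lia.
  by congr 'C(_, _); lia.
rewrite num_weight_covered; last by lia.
(* Terms [j < s] involve sets larger than [d], the term [j = s] sets of size [d], and later terms
   vanish. *)
rewrite (@big_cat_nat _ _ _ s) //=; last by lia.
congr (_ + _).
  rewrite mulr_sumr; apply: eq_big_nat => j js.
  have -> : num_covered C (d + s - j) =
      ('C(n, d + s - j) * (#|F| ^ (s - j)).-1)%N.
    by rewrite num_covered_gt; [congr (_ * (_ ^ _).-1)%N; lia | lia].
  rewrite natrM natr_pred_card.
  (* Trades ['C(n, d + s - j) * 'C(n - (d + s - j), j)] for ['C(n, d + s) * 'C(d + s, j)], so the
     first factor leaves the sum. *)
  have := @bin_trinomial n (d + s) (d + s - j) (leq_subr _ _).
  rewrite bin_sub; last by lia.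
  rewrite (_ : d + s - (d + s - j) = j)%N; last by lia.
  move/(congr1 (fun m => m%:R : rat)); rewrite !natrM => E.
  rewrite [RHS]mulrA [X in _ = X * _]mulrCA E; ring.
rewrite big_ltn; last by lia.
rewrite big_nat_cond big1 ?addr0; last first.
  by move=> j jd; rewrite num_covered_lt ?mulr0 //; lia.
rewrite addnK subKn; last by lia.
by rewrite num_covered_min natrM -(natr_pred_card 1) expn1.
Qed.

End NearMDS.

(** * All lifted codes at once *)

Lemma num_min_supports_map (F K : finFieldType) (iota : {rmorphism F -> K})
    r n (H : 'M[F]_(r, n)) d :
  num_min_supports (map_mx iota H) d = num_min_supports H d.
Proof. by apply: eq_card => T; rewrite !inE shorten_dim_map. Qed.

Theorem theorem3p5 (F : finFieldType) (n k d : nat)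
    (C : {vspace 'rV[F]_n}) (H : 'M[F]_(n - k, n))
    (hd : d = (n - k)%N) (hC : is_NMDS k C) (hH : is_parity_check H C) :
  (forall (m : nat) (K : finFieldType) (iota : {rmorphism F -> K}),
     (1 <= m)%N -> #|K| = (#|F| ^ m)%N ->
     [/\ is_NMDS k (lifted_code iota H),
         (m = 1%N ->
          [set y : 'rV[K]_n | y \in lifted_code iota H] =
          [set map_mx iota x | x : 'rV[F]_n in C])
       & forall s : nat, (1 <= s)%N ->
         (num_weight (d + s) (lifted_code iota H))%:R =
         (binz n (k%:Z - s%:Z))%:R *
           (\sum_(0 <= j < s)
              (-1) ^+ j * 'C(d + s, j)%:R *
              ((#|F|%:R : rat) ^+ (m * (s - j)) - 1)) +
         (-1) ^+ s * 'C(k, s)%:R *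
           ((num_weight d C)%:R / (#|F|%:R - 1)) *
           (#|F|%:R ^+ m - 1) :> rat]) /\
  ((num_weight d C)%:R = 'C(n, k - 1)%:R * ((#|F|%:R - 1) / k%:R) :> rat ->
   num_weight (d + 1) C = 0%N /\
   (forall (m : nat) (K : finFieldType) (iota : {rmorphism F -> K}),
      (1 <= m)%N -> #|K| = (#|F| ^ m)%N ->
      (num_weight d (lifted_code iota H))%:R =
        'C(n, k - 1)%:R * ((#|F|%:R ^+ m - 1) / k%:R) :> rat /\
      num_weight (d + 1) (lifted_code iota H) = 0%N)).
Proof.
rewrite /is_parity_check in hH; subst C d; set N := num_min_supports H (n - k).
have q1 : #|F|%:R - 1 != 0 :> rat.
  by rewrite subr_eq0 pnatr_eq1; have := finNzRing_gt1 F; case: eqP => // ->.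
have ratioN :
    (num_weight (n - k) (null_code H))%:R / (#|F|%:R - 1) = N%:R :> rat.
  by rewrite num_weight_min // mulfK.
have k0 : k%:R != 0 :> rat.
  by have [/andP[kpos _] _] := NMDS_bounds hC; rewrite pnatr_eq0 -lt0n.
have liftNMDS (K : finFieldType) (iota : {rmorphism F -> K}) :=
  is_NMDS_lifted iota hC.
have formula m (K : finFieldType) (iota : {rmorphism F -> K}) s :
    #|K| = (#|F| ^ m)%N -> (1 <= s)%N ->
    (num_weight (n - k + s) (lifted_code iota H))%:R =
    (binz n (k%:Z - s%:Z))%:R *
      (\sum_(0 <= j < s) (-1) ^+ j * 'C(n - k + s, j)%:R *
         ((#|F|%:R : rat) ^+ (m * (s - j)) - 1)) +
    (-1) ^+ s * 'C(k, s)%:R * N%:R * (#|F|%:R ^+ m - 1) :> rat.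
  move=> cardK s0; rewrite (num_weight_NMDS (liftNMDS K iota)) //.
  rewrite num_min_supports_map cardK natrX mulrA; congr (_ * _ + _).
  by apply: eq_bigr => j _; rewrite exprM.
split=> [m K iota m0 cardK | extremal].
  split; first exact: liftNMDS.
    by move=> m1; apply: lifted_code_bij; rewrite cardK m1 expn1.
  by move=> s s0; rewrite ratioN (formula m).
(* The extremal value of [A_d] fixes [N], hence the weight counts of every lift. *)
have NE : N%:R = 'C(n, k - 1)%:R / k%:R :> rat.
  by rewrite -ratioN extremal; field; rewrite k0 q1.
(* At [s = 1] the formula reads [('C(n, k - 1) - k * N) * (q ^ m - 1)], and its first factor is 0 by
   [NE]. *)
have next0 m (K : finFieldType) (iota : {rmorphism F -> K}) :
    #|K| = (#|F| ^ m)%N -> num_weight (n - k + 1) (lifted_code iota H) = 0%N.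
  move=> cardK; apply/eqP; rewrite -(pnatr_eq0 rat) (formula m) //.
  have [kn _] := NMDS_bounds hC.
  rewrite subzn /=; last by lia.
  rewrite big_nat1 bin0 bin1 NE muln1 expr0 expr1; apply/eqP; field.
  exact: k0.
split=> [|m K iota m0 cardK].
  (* The code itself is its lift along the identity, with [m = 1]. *)
  by rewrite -(lifted_code_id H) (next0 1%N) ?expn1.
split; last exact: next0 cardK.
rewrite (num_weight_min (liftNMDS K iota)) num_min_supports_map.
by rewrite cardK natrX -/N NE; field.
Qed.
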